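(* Consider the step-by-step construction of $16$ lines in the projective plane, depending on two parameters $a,b$ with $a\neq 0$, $a\neq 1$, $b\neq 0$, $b\neq 1$, $a\neq b$, described in the context. In it some of the points are not always triple; the conditions to have them triple are that the lines in each of the following seven triples be concurrent: $$\begin{aligned}&P_3P_{14},\ P_8P_{20},\ P_{12}P_{19};\qquad P_3P_6,\ P_{13}P_{17},\ P_{15}P_{18};\qquad P_2P_4,\ P_8P_{20},\ P_{15}P_{18};\\ &P_2P_{14},\ P_{10}P_{16},\ P_{13}P_{17};\qquad P_2P_5,\ P_{12}P_{19},\ P_{21}P_{22};\\ &P_1P_6,\ P_8P_{20},\ P_{21}P_{22};\qquad P_1P_7,\ P_{10}P_{16},\ P_{15}P_{18}.\end{aligned}$$ This gives the condition on $a$ and $b$ $$C_{16}:\quad a^4b^2-2a^3b-2a^2b^2+a^2b+2ab^2-b^3+a^2+2b^2-2b=0,$$ and $C_{16}$ is the curve parametrizing the configurations $\mathbb{B}_{16}$.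
   Context: Original Böröczky configuration of $n$ lines: fix a point $Q_0$ on a circle and let $Q_\alpha$ be its rotation by the angle $\alpha$ about the center; the lines are $Q_\alpha Q_{\pi-2\alpha}$, $\alpha=2k\pi/n$, $k=0,\dots,n-1$ (the tangent at $Q_\alpha$ if $\alpha\equiv\pi-2\alpha$ mod $2\pi$). It has $\lfloor n(n-3)/6\rfloor+1$ triple points (points where three of the lines meet), i.e. $35$ for $n=16$. A configuration $\mathbb{B}_n$ is a modification of it: $n$ lines in the projective plane with the same incidences; it is degenerate if some of its points or lines coincide. The curve parametrizing the $\mathbb{B}_n$ is the curve of parameter values $(a,b)$ satisfying the condition for the construction to produce all the required triple points; individual points of this curve may still give degenerate configurations. Construction of $\mathbb{B}_{16}$ ($XY$ denotes the line through $X$ and $Y$). Points $P_1=(1:0:0)$, $P_2=(0:1:0)$, $P_3=(0:0:1)$, $P_4=(1:1:1)$. Lines $P_1P_4,\ P_2P_4,\ P_3P_4$. Parameter point $P_5=(a:1:1)\in P_1P_4$. Lines $P_2P_5,\ P_3P_5$. Points $P_6=P_2P_4\cap P_3P_5$, $P_7=P_3P_4\cap P_2P_5$. Lines $P_1P_6,\ P_1P_7$. Points $P_8=P_3P_5\cap P_1P_7$, $P_9=P_2P_4\cap P_1P_7$, $P_{10}=P_1P_6\cap P_2P_5$, $P_{11}=P_3P_4\cap P_1P_6$. Line $P_9P_{11}$. Points $P_{12}=P_9P_{11}\cap P_3P_5$, $P_{13}=P_9P_{11}\cap P_2P_5$, and the parameter point $P_{14}=(b:1:1)\in P_1P_4$.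 Lines $P_2P_{14},\ P_3P_{14}$. Points $P_{15}=P_3P_{14}\cap P_1P_6$, $P_{16}=P_3P_{14}\cap P_9P_{11}$, $P_{17}=P_3P_{14}\cap P_1P_7$, $P_{18}=P_2P_{14}\cap P_3P_4$, $P_{19}=P_2P_{14}\cap P_1P_6$, $P_{20}=P_2P_{14}\cap P_9P_{11}$, $P_{21}=P_2P_{14}\cap P_1P_7$, $P_{22}=P_2P_4\cap P_3P_{14}$. Lines $P_8P_{20},\ P_{10}P_{16},\ P_{12}P_{19},\ P_{13}P_{17},\ P_{15}P_{18},\ P_{21}P_{22}$. Points $P_{23}=P_3P_{14}\cap P_8P_{20}$, $P_{24}=P_{15}P_{18}\cap P_{13}P_{17}$, $P_{25}=P_{13}P_{17}\cap P_8P_{20}$, $P_{26}=P_{13}P_{17}\cap P_1P_4$, $P_{27}=P_2P_4\cap P_{15}P_{18}$, $P_{28}=P_{10}P_{16}\cap P_{13}P_{17}$, $P_{29}=P_2P_4\cap P_{10}P_{16}$, $P_{30}=P_2P_5\cap P_{12}P_{19}$, $P_{31}=P_{10}P_{16}\cap P_3P_4$, $P_{32}=P_1P_4\cap P_{15}P_{18}$, $P_{33}=P_1P_6\cap P_8P_{20}$, $P_{34}=P_1P_7\cap P_{10}P_{16}$, $P_{35}=P_1P_4\cap P_{10}P_{16}$. *)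

(* Defs.v *)
From HB Require Import structures.
From mathcomp Require Import all_boot all_order all_algebra.
From mathcomp Require Import reals trigo.

Set Implicit Arguments.
Unset Strict Implicit.
Unset Printing Implicit Defensive.

Import Order.TTheory GRing.Theory Num.Theory.
Local Open Scope ring_scope.

(* Points and lines of the projective plane over F are both given by nonzero
   row vectors of homogeneous coordinates, so that [cross] computes the line
   through two distinct points as well as the intersection point of two
   distinct lines (and yields 0 when its arguments coincide). *)
Definition row3 (F : fieldType) (x y z : F) : 'rV[F]_3 :=
  \row_(j < 3) [:: x; y; z]`_j.

Definition cross (F : fieldType) (u v : 'rV[F]_3) : 'rV[F]_3 :=
  let u_ k := u 0 (inord k) in let v_ k := v 0 (inord k) in
  row3 (u_ 1 * v_ 2 - u_ 2 * v_ 1)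
       (u_ 2 * v_ 0 - u_ 0 * v_ 2)
       (u_ 0 * v_ 1 - u_ 1 * v_ 0).

Definition on_line (F : fieldType) (p l : 'rV[F]_3) : bool := p *m l^T == 0.

Definition concurrent (F : fieldType) (l1 l2 l3 : 'rV[F]_3) : Prop :=
  exists p : 'rV[F]_3, [/\ p != 0, on_line p l1, on_line p l2 & on_line p l3].

(* The original configuration, on the unit circle with Q_0 = (1, 0). *)
Definition circle_point (R : realType) (t : R) : 'rV[R]_3 :=
  row3 (cos t) (sin t) 1.

Definition circle_tangent (R : realType) (t : R) : 'rV[R]_3 :=
  row3 (cos t) (sin t) (-1).

(* The affine representatives of two points of the circle are equal exactly
   when the angles are equal modulo 2 pi. *)
Definition boroczky_line (R : realType) (n k : nat) : 'rV[R]_3 :=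
  let t : R := 2 * k%:R * pi / n%:R in
  if circle_point t == circle_point (pi - 2 * t) then circle_tangent t
  else cross (circle_point t) (circle_point (pi - 2 * t)).

Section Construction.
Variables (F : fieldType) (a b : F).

Let P1 : 'rV[F]_3 := row3 1 0 0.
Let P2 : 'rV[F]_3 := row3 0 1 0.
Let P3 : 'rV[F]_3 := row3 0 0 1.
Let P4 : 'rV[F]_3 := row3 1 1 1.
Let P5 : 'rV[F]_3 := row3 a 1 1.
Let P6 := cross (cross P2 P4) (cross P3 P5).
Let P7 := cross (cross P3 P4) (cross P2 P5).
Let P8 := cross (cross P3 P5) (cross P1 P7).
Let P9 := cross (cross P2 P4) (cross P1 P7).
Let P10 := cross (cross P1 P6) (cross P2 P5).
Let P11 := cross (cross P3 P4) (cross P1 P6).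
Let P12 := cross (cross P9 P11) (cross P3 P5).
Let P13 := cross (cross P9 P11) (cross P2 P5).
Let P14 : 'rV[F]_3 := row3 b 1 1.
Let P15 := cross (cross P3 P14) (cross P1 P6).
Let P16 := cross (cross P3 P14) (cross P9 P11).
Let P17 := cross (cross P3 P14) (cross P1 P7).
Let P18 := cross (cross P2 P14) (cross P3 P4).
Let P19 := cross (cross P2 P14) (cross P1 P6).
Let P20 := cross (cross P2 P14) (cross P9 P11).
Let P21 := cross (cross P2 P14) (cross P1 P7).
Let P22 := cross (cross P2 P4) (cross P3 P14).
Let P23 := cross (cross P3 P14) (cross P8 P20).
Let P24 := cross (cross P15 P18) (cross P13 P17).
Let P25 := cross (cross P13 P17) (cross P8 P20).
Let P26 := cross (cross P13 P17) (cross P1 P4).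
Let P27 := cross (cross P2 P4) (cross P15 P18).
Let P28 := cross (cross P10 P16) (cross P13 P17).
Let P29 := cross (cross P2 P4) (cross P10 P16).
Let P30 := cross (cross P2 P5) (cross P12 P19).
Let P31 := cross (cross P10 P16) (cross P3 P4).
Let P32 := cross (cross P1 P4) (cross P15 P18).
Let P33 := cross (cross P1 P6) (cross P8 P20).
Let P34 := cross (cross P1 P7) (cross P10 P16).
Let P35 := cross (cross P1 P4) (cross P10 P16).

Definition points : seq 'rV[F]_3 :=
  [:: P1; P2; P3; P4; P5; P6; P7; P8; P9; P10; P11; P12; P13; P14; P15; P16;
      P17; P18; P19; P20; P21; P22; P23; P24; P25; P26; P27; P28; P29; P30;
      P31; P32; P33; P34; P35].

(* Shift by one: the point P_i is [P i], for 1 <= i <= 35. *)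
Definition P (i : nat) : 'rV[F]_3 := points`_i.-1.

Definition PP (i j : nat) : 'rV[F]_3 := cross (P i) (P j).

(* The sixteen lines of the construction.  The order is the one in which the
   k-th line plays the role of the line Q_t Q_(pi - 2t), t = 2 k pi / 16, of
   the original configuration. *)
Definition lines : seq 'rV[F]_3 :=
  [:: PP 1 4; PP 2 4; PP 12 19; PP 8 20; PP 21 22; PP 2 14; PP 3 5; PP 1 7;
      PP 9 11; PP 1 6; PP 2 5; PP 3 14; PP 15 18; PP 10 16; PP 13 17; PP 3 4].

Definition L (k : 'I_16) : 'rV[F]_3 := lines`_k.

Definition triple_point (p : 'rV[F]_3) : Prop :=
  p != 0 /\ (3 <= #|[set k | on_line p (L k)]|)%N.

(* The construction produces all the required triple points: all of
   P_1, ..., P_35 are triple, and whenever three lines of the original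
   configuration meet in a point, the corresponding three lines meet in one
   of P_1, ..., P_35.  Some of the points or lines may still coincide. *)
Definition produces_triple_points (R : realType) : Prop :=
  (forall i, (1 <= i <= 35)%N -> triple_point (P i)) /\
  (forall i j k : 'I_16, i != j -> i != k -> j != k ->
     concurrent (boroczky_line R 16 i) (boroczky_line R 16 j)
                (boroczky_line R 16 k) ->
     exists2 n, (1 <= n <= 35)%N &
       [/\ on_line (P n) (L i), on_line (P n) (L j) & on_line (P n) (L k)]).

Definition seven_concurrences : Prop :=
  concurrent (PP 3 14) (PP 8 20) (PP 12 19) /\
  concurrent (PP 3 6) (PP 13 17) (PP 15 18) /\
  concurrent (PP 2 4) (PP 8 20) (PP 15 18) /\
  concurrent (PP 2 14) (PP 10 16) (PP 13 17) /\
  concurrent (PP 2 5) (PP 12 19) (PP 21 22) /\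
  concurrent (PP 1 6) (PP 8 20) (PP 21 22) /\
  concurrent (PP 1 7) (PP 10 16) (PP 15 18).

Definition C16 : F :=
  a ^+ 4 * b ^+ 2 - 2 * a ^+ 3 * b - 2 * a ^+ 2 * b ^+ 2 + a ^+ 2 * b
  + 2 * a * b ^+ 2 - b ^+ 3 + a ^+ 2 + 2 * b ^+ 2 - 2 * b.

End Construction.

(* Main.v *)
Require Import Defs.
From mathcomp Require Import all_boot all_order all_algebra.
From mathcomp Require Import reals trigo.
From mathcomp Require Import ring.
Import Order.TTheory GRing.Theory Num.Theory.
Local Open Scope ring_scope.

Set Implicit Arguments.
Unset Strict Implicit.
Unset Printing Implicit Defensive.

(** With [h] the half angle, the line Q_(2h) Q_(pi - 4h) has the equation
    x sin h + y cos h = sin 3h, and the determinant of three such lines factors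
    as 4 sin (h1 - h2) sin (h2 - h3) sin (h1 - h3) sin (h1 + h2 + h3).  So the
    lines of indices i, j, k of the original configuration concur exactly when
    n divides i + j + k, which for n = 16 gives 35 triples, one for each P_n.
    In the homogeneous coordinates of the construction, each of the 105
    incidences of a point with a line of its triple either holds identically or
    is a multiple of C16, and the determinant of P_2P_4, P_8P_20, P_15P_18 is
    -C16.  On C16 the excluded values of a and b also force a + 1 != 0, which
    is what keeps the 35 constructed vectors from vanishing. *)

(** * Homogeneous coordinates *)

Section HomogeneousCoordinates.
Variable F : fieldType.
Implicit Types (u v p l : 'rV[F]_3) (c d e : F * F * F) (k : F).

Definition cross3 c d : F * F * F :=
  (c.1.2 * d.2 - c.2 * d.1.2, c.2 * d.1.1 - c.1.1 * d.2,
   c.1.1 * d.1.2 - c.1.2 * d.1.1).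

Definition dot3 c d : F := c.1.1 * d.1.1 + c.1.2 * d.1.2 + c.2 * d.2.

Definition scale3 k c : F * F * F := (k * c.1.1, k * c.1.2, k * c.2).

Definition row_of c : 'rV[F]_3 := row3 c.1.1 c.1.2 c.2.

(** Plain triples reduce by computation to polynomial goals for [ring], which row vectors do not.
    The free nonzero scalar [k] allows common factors to be cancelled at every stage of the
    construction. *)
Definition has_coords u c := exists2 k, k != 0 & u = row_of (scale3 k c).

Lemma row_of0E c : row_of c 0 (inord 0) = c.1.1.
Proof. by rewrite mxE inordK. Qed.

Lemma row_of1E c : row_of c 0 (inord 1) = c.1.2.
Proof. by rewrite mxE inordK. Qed.

Lemma row_of2E c : row_of c 0 (inord 2) = c.2.
Proof. by rewrite mxE inordK. Qed.

Lemma row_of_surj u : exists c, u = row_of c.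
Proof.
exists (u 0 (inord 0), u 0 (inord 1), u 0 (inord 2)).
apply/rowP=> -[[|[|[|//]]] lt3]; rewrite mxE /=; congr (u 0 _);
  by apply/val_inj; rewrite /= inordK.
Qed.

Lemma row_of_inj : injective row_of.
Proof.
move=> [[x y] z] d cd; rewrite [d]surjective_pairing [d.1]surjective_pairing.
rewrite -(row_of0E d) -(row_of1E d) -(row_of2E d) -cd.
by rewrite row_of0E row_of1E row_of2E.
Qed.

Lemma row_of_eq0 c : (row_of c == 0) = (c == (0, 0, 0)).
Proof.
have <- : row_of (0, 0, 0) = 0 by apply/rowP=> -[[|[|[|//]]] lt3]; rewrite !mxE.
by rewrite (inj_eq row_of_inj).
Qed.

Lemma cross_row_of c d : cross (row_of c) (row_of d) = row_of (cross3 c d).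
Proof. by rewrite /cross !row_of0E !row_of1E !row_of2E. Qed.

Lemma on_line_row_of c d : on_line (row_of c) (row_of d) = (dot3 c d == 0).
Proof.
have mulE : (row_of c *m (row_of d)^T) 0 0 = dot3 c d.
  by rewrite mxE !big_ord_recl big_ord0 !mxE /dot3 addr0 addrA.
apply/eqP/eqP=> [cd0|cd0]; first by rewrite -mulE cd0 mxE.
by apply/matrixP=> i j; rewrite !ord1 mulE cd0 mxE.
Qed.

Lemma has_coords_row3 x y z : has_coords (row3 x y z) (x, y, z).
Proof. by exists 1; rewrite ?oner_eq0 // /row_of /= !mul1r. Qed.

Lemma has_coords_neq0 u c : has_coords u c -> (u != 0) = (c != (0, 0, 0)).
Proof.
move=> [k k0 ->]; rewrite row_of_eq0; case: c => [[x y] z].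
by rewrite /scale3 /= !xpair_eqE !mulf_eq0 (negPf k0).
Qed.

Lemma has_coords_on_line u v c d : has_coords u c -> has_coords v d ->
  on_line u v = (dot3 c d == 0).
Proof.
move=> [k k0 ->] [m m0 ->]; rewrite on_line_row_of.
have -> : dot3 (scale3 k c) (scale3 m d) = k * m * dot3 c d.
  by rewrite /dot3 /=; ring.
by rewrite !mulf_eq0 (negPf k0) (negPf m0).
Qed.

(** The factor [k] is what gets divided out of the cross product; its being nonzero says that no
    point or line is lost by the cancellation. *)
Lemma has_coords_cross u v c d k e : has_coords u c -> has_coords v d ->
  k != 0 -> cross3 c d = scale3 k e -> has_coords (cross u v) e.
Proof.
move=> [i i0 ->] [j j0 ->] k0 ce; exists (i * j * k).
  by rewrite !mulf_neq0.
rewrite cross_row_of; congr row_of; move: ce => [ce0 ce1 ce2].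
by congr (_, _, _); rewrite -mulrA -?ce0 -?ce1 -?ce2 /=; ring.
Qed.

(** A common point is a nonzero vector in the kernel of the matrix of the three lines, whose
    determinant is this triple product. *)
Lemma concurrent_dot3 l1 l2 l3 c1 c2 c3 :
    has_coords l1 c1 -> has_coords l2 c2 -> has_coords l3 c3 ->
  concurrent l1 l2 l3 -> dot3 (cross3 c1 c2) c3 = 0.
Proof.
move=> h1 h2 h3 [p [p0 p1 p2 p3]]; have [c pE] := row_of_surj p.
have hp : has_coords p c by rewrite pE; apply: has_coords_row3.
move: p0 p1 p2 p3; rewrite (has_coords_neq0 hp) (has_coords_on_line hp h1).
rewrite (has_coords_on_line hp h2) (has_coords_on_line hp h3).
set D := dot3 (cross3 _ _) _ => c0 /eqP c1E /eqP c2E /eqP c3E.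
apply/eqP; apply: contraNT c0 => D0; move: c1E c2E c3E D0; rewrite /D.
case: c {hp pE D} => [[x y] z]; case: c1 {h1} => [[x1 y1] z1].
case: c2 {h2} => [[x2 y2] z2]; case: c3 {h3} => [[x3 y3] z3].
rewrite /dot3 /cross3 /= => c1E c2E c3E D0.
(* Cramer's rule *)
suff [x0 y0 z0] : [/\ x = 0, y = 0 & z = 0] by rewrite x0 y0 z0.
split; apply: (mulfI D0); rewrite mulr0.
- transitivity ((x * x1 + y * y1 + z * z1) * (y2 * z3 - z2 * y3)
    + (x * x2 + y * y2 + z * z2) * (y3 * z1 - z3 * y1)
    + (x * x3 + y * y3 + z * z3) * (y1 * z2 - z1 * y2)); first by ring.
  by rewrite c1E c2E c3E !mul0r !addr0.
- transitivity ((x * x1 + y * y1 + z * z1) * (z2 * x3 - x2 * z3)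
    + (x * x2 + y * y2 + z * z2) * (z3 * x1 - x3 * z1)
    + (x * x3 + y * y3 + z * z3) * (z1 * x2 - x1 * z2)); first by ring.
  by rewrite c1E c2E c3E !mul0r !addr0.
- transitivity ((x * x1 + y * y1 + z * z1) * (x2 * y3 - y2 * x3)
    + (x * x2 + y * y2 + z * z2) * (x3 * y1 - y3 * x1)
    + (x * x3 + y * y3 + z * z3) * (x1 * y2 - y1 * x2)); first by ring.
  by rewrite c1E c2E c3E !mul0r !addr0.
Qed.

(** The witness is the intersection of the first two lines, a genuine point because their cross
    product is nonzero. *)
Lemma dot3_concurrent l1 l2 l3 c1 c2 c3 :
    has_coords l1 c1 -> has_coords l2 c2 -> has_coords l3 c3 ->
  cross3 c1 c2 != (0, 0, 0) -> dot3 (cross3 c1 c2) c3 = 0 ->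
  concurrent l1 l2 l3.
Proof.
move=> h1 h2 h3 c12 D0; exists (row_of (cross3 c1 c2)).
have hp : has_coords (row_of (cross3 c1 c2)) (cross3 c1 c2).
  exact: has_coords_row3.
rewrite (has_coords_neq0 hp) (has_coords_on_line hp h1).
rewrite (has_coords_on_line hp h2) (has_coords_on_line hp h3) D0 eqxx; split=> //.
  by apply/eqP; rewrite /dot3 /=; ring.
by apply/eqP; rewrite /dot3 /=; ring.
Qed.

(** Serves as a certificate: the multipliers are polynomials in the parameters, and [m] is a product
    of factors already known to be nonzero. *)
Lemma coords_neq0 (m1 m2 m3 x y z m : F) :
  m != 0 -> m1 * x + m2 * y + m3 * z = m -> (x, y, z) != (0, 0, 0).
Proof.
move=> m0 mE; apply: contra_neq m0 => -[x0 y0 z0];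
by rewrite -mE x0 y0 z0 !mulr0 !addr0.
Qed.

End HomogeneousCoordinates.

(** * The lines of the original configuration *)

Section OriginalConfiguration.
Variable R : realType.

(** Reducing k modulo n shifts the angle by a multiple of pi, which only affects the sign; the sine
    is positive strictly between 0 and pi, so only remainder 0 gives a zero. *)
Lemma sin_mulpi_div_eq0 (n k : nat) : (0 < n)%N ->
  (sin (k%:R * pi / n%:R : R) == 0) = (n %| k)%N.
Proof.
move=> n0; have nR0 : n%:R != 0 :> R by rewrite pnatr_eq0 -lt0n.
have -> : k%:R * pi / n%:R = (k %% n)%:R * pi / n%:R + pi *+ (k %/ n) :> R.
  rewrite {1}(divn_eq k n) natrD natrM -mulr_natr; field; exact: nR0.
rewrite (alternatingn (@sinDpi R)) mulf_eq0 signr_eq0 /=.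
apply/idP/idP=> [|nk]; last by rewrite (eqP nk) !mul0r sin0.
apply: contraTT; rewrite /dvdn -lt0n => r0.
have pi0 := pi_gt0 R.
rewrite gt_eqF // sin_gt0_pi //; apply/andP; split.
  by rewrite divr_gt0 ?mulr_gt0 ?ltr0n.
by rewrite ltr_pdivrMr ?ltr0n // mulrC ltr_pM2l // ltr_nat ltn_mod.
Qed.

Definition boroczky_coords (h : R) : R * R * R := (sin h, cos h, - sin (h *+ 3)).

(** Here the angle is 2h. The cross product of the endpoints Q_(2h) and Q_(pi - 4h) is -2 cos 3h
    times these coordinates, and cos 3h vanishes exactly when the endpoints coincide. In that case
    sin 3h is 1 or -1 and is the scalar that relates the tangent to the same coordinates. *)
Lemma boroczky_lineP (n k : nat) : (0 < n)%N ->
  has_coords (boroczky_line R n k) (boroczky_coords (k%:R * pi / n%:R)).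
Proof.
move=> n0; rewrite /boroczky_line -[2 * _ * _]mulrA -[2 * _ / _]mulrA.
set h := _ / n%:R; rewrite /boroczky_coords.
have e1 : cos h * cos h + sin h * sin h = 1 by rewrite -!expr2 cos2Dsin2.
have c2 : cos (2 * h) = cos h * cos h - sin h * sin h.
  by rewrite mulr_natl mulr2n cosD.
have s2 : sin (2 * h) = sin h * cos h + cos h * sin h.
  by rewrite mulr_natl mulr2n sinD.
have cp : cos (pi - 2 * (2 * h)) = sin (2 * h) * sin (2 * h)
    - cos (2 * h) * cos (2 * h).
  rewrite cosB cospi sinpi mul0r addr0 mulN1r mulr_natl mulr2n cosD; ring.
have sp : sin (pi - 2 * (2 * h)) = 2 * sin (2 * h) * cos (2 * h).
  rewrite sinB cospi sinpi mul0r sub0r mulN1r opprK mulr_natl mulr2n sinD; ring.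
have s3 : sin (h *+ 3) = sin h * (3 * cos h ^+ 2 - sin h ^+ 2).
  rewrite mulrS sinD -[h *+ 2]mulr_natl s2 c2; ring.
(* This is cos 3h, expanded in sin h and cos h. *)
pose c3 := cos h * (cos h ^+ 2 - 3 * sin h ^+ 2).
have dx : sin (2 * h) - sin (pi - 2 * (2 * h)) = - 2 * c3 * sin h.
  (* For [ring], sine and cosine are independent, so the difference of the two sides is first
     displayed as a multiple of 1 - (cos^2 h + sin^2 h). *)
  rewrite sp s2 c2 /c3; apply/eqP; rewrite -subr_eq0; apply/eqP.
  transitivity (2 * sin h * cos h * (1 - (cos h * cos h + sin h * sin h))).
    by ring.
  by rewrite e1 subrr mulr0.
have dy : cos (pi - 2 * (2 * h)) - cos (2 * h) = - 2 * c3 * cos h.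
  rewrite cp s2 c2 /c3; apply/eqP; rewrite -subr_eq0; apply/eqP.
  transitivity ((cos h * cos h - sin h * sin h)
    * ((cos h * cos h + sin h * sin h) - 1)); first by ring.
  by rewrite e1 subrr mulr0.
have e3 : c3 ^+ 2 + sin (h *+ 3) ^+ 2 = 1.
  rewrite s3 /c3; transitivity ((cos h * cos h + sin h * sin h) ^+ 3).
    by ring.
  by rewrite e1 expr1n.
have two0 : (2 : R) != 0 by rewrite pnatr_eq0.
have pointE : (circle_point (2 * h) == circle_point (pi - 2 * (2 * h)))
    = (c3 == 0).
  apply/eqP/eqP=> [pE|c30].
    have [cE sE] := row_of_inj (pE : row_of (_, _, _) = row_of (_, _, _)).
    move: dx dy; rewrite -sE -cE !subrr => dx dy.
    apply: (mulfI two0); rewrite mulr0.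
    (* The two vanishing differences, weighted by sin h and cos h, add up to 2 cos 3h. *)
    transitivity ((- (- 2 * c3 * sin h)) * sin h + (- (- 2 * c3 * cos h)) * cos h
      + 2 * c3 * (1 - (cos h * cos h + sin h * sin h))); first by ring.
    by rewrite -dx -dy e1 subrr oppr0 !(mul0r, mulr0) !addr0.
  rewrite /circle_point; congr row3; apply/eqP; rewrite -subr_eq0.
    by rewrite -oppr_eq0 opprB dy c30 mulr0 mul0r.
  by rewrite dx c30 mulr0 mul0r.
rewrite pointE; case: eqP => [c30|/eqP c30].
  rewrite c30 expr0n /= add0r in e3.
  exists (sin (h *+ 3)).
    by apply: contra_eq_neq e3 => ->; rewrite expr0n /= eq_sym oner_eq0.
  rewrite /circle_tangent /row_of /=; congr row3.
  (* The first two coordinates are the subtraction formulas for 2h = 3h - h, in which the terms with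
     cos 3h drop out. *)
  - transitivity (cos (2 * h) * (cos h * cos h + sin h * sin h) - c3 * cos h).
      by rewrite e1 mulr1 c30 mul0r subr0.
    rewrite c2 s3 /c3; ring.
  - transitivity (sin (2 * h) * (cos h * cos h + sin h * sin h) + c3 * sin h).
      by rewrite e1 mulr1 c30 mul0r addr0.
    rewrite s2 s3 /c3; ring.
  - by rewrite mulrN -expr2 e3.
have hP t : has_coords (circle_point t) (cos t, sin t, 1 : R).
  exact: has_coords_row3.
apply: (has_coords_cross (k := - 2 * c3)) (hP _) (hP _) _ _.
  by rewrite mulf_neq0 // oppr_eq0.
rewrite /cross3 /scale3 /= mulr1 mul1r -dx mulr1 mul1r -dy; congr (_, _, _).
rewrite cp sp s2 c2 s3 /c3; ring.
Qed.

Lemma boroczky_coords_dot3 (g h i : R) :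
  dot3 (cross3 (boroczky_coords g) (boroczky_coords h)) (boroczky_coords i)
  = 4 * sin (g - h) * sin (h - i) * sin (g - i) * sin (g + h + i).
Proof.
have e x : cos x ^+ 2 + sin x ^+ 2 = 1 :> R by rewrite cos2Dsin2.
have s3 x : sin (x *+ 3) = sin x * (3 * cos x ^+ 2 - sin x ^+ 2).
  by rewrite mulrS sinD mulr2n cosD sinD; ring.
rewrite /dot3 /= !s3 !(sinD, cosD, sinN, cosN).
(* The powers of [cos^2 + sin^2] make both sides homogeneous, so that they agree
   as polynomials in the sines and cosines. *)
transitivity
  (sin i * (cos g * - (sin h * (3 * cos h ^+ 2 - sin h ^+ 2))
        * (cos g ^+ 2 + sin g ^+ 2)
      - - (sin g * (3 * cos g ^+ 2 - sin g ^+ 2)) * cos h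
        * (cos h ^+ 2 + sin h ^+ 2))
     * (cos i ^+ 2 + sin i ^+ 2)
   + cos i * (- (sin g * (3 * cos g ^+ 2 - sin g ^+ 2)) * sin h
        * (cos h ^+ 2 + sin h ^+ 2)
      - sin g * - (sin h * (3 * cos h ^+ 2 - sin h ^+ 2))
        * (cos g ^+ 2 + sin g ^+ 2))
     * (cos i ^+ 2 + sin i ^+ 2)
   + - (sin i * (3 * cos i ^+ 2 - sin i ^+ 2)) * (sin g * cos h - cos g * sin h)
     * (cos g ^+ 2 + sin g ^+ 2) * (cos h ^+ 2 + sin h ^+ 2)).
  by rewrite !e !mulr1; ring.
ring.
Qed.

(** The angle is (i - j) pi / n with 0 < |i - j| < n. This keeps the three difference factors of the
    determinant away from zero. *)
Lemma sin_diff_neq0 (n i j : nat) : (i < n)%N -> (j < n)%N -> i != j ->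
  sin (i%:R * pi / n%:R - j%:R * pi / n%:R : R) != 0.
Proof.
wlog ji : i j / (j <= i)%N => [wlog_ji|] ltin ltjn ij.
  have [ji|/ltnW ij'] := leqP j i; first exact: wlog_ji.
  by rewrite -opprB sinN oppr_eq0 wlog_ji // eq_sym.
rewrite -!mulrBl -natrB // sin_mulpi_div_eq0 ?(leq_ltn_trans _ ltin) //.
have d0 : (0 < i - j)%N by rewrite subn_gt0 ltn_neqAle eq_sym ij.
by rewrite (gtnNdvd d0) // (leq_ltn_trans (leq_subr j i)).
Qed.

Lemma boroczky_concurrent (n i j k : nat) : (i < n)%N -> (j < n)%N -> (k < n)%N ->
    i != j -> i != k -> j != k ->
  concurrent (boroczky_line R n i) (boroczky_line R n j) (boroczky_line R n k)
  <-> (n %| i + j + k)%N.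
Proof.
move=> ltin ltjn ltkn ij ik jk; have n0 : (0 < n)%N by apply: leq_trans ltin.
rewrite -(sin_mulpi_div_eq0 _ n0) !natrD !mulrDl.
have hi := boroczky_lineP i n0; have hj := boroczky_lineP j n0.
have hk := boroczky_lineP k n0.
split=> [/(concurrent_dot3 hi hj hk)/eqP|/eqP s0].
  rewrite boroczky_coords_dot3 !mulf_eq0 pnatr_eq0 /=.
  by rewrite !(negPf (sin_diff_neq0 _ _ _)).
apply: (dot3_concurrent hi hj hk); last by rewrite boroczky_coords_dot3 s0 mulr0.
(* The third coordinate of the intersection of lines i and j is the sine of the difference of their
   half angles. *)
rewrite xpair_eqE negb_and; apply/orP; right => /=.
by rewrite -sinB sin_diff_neq0.
Qed.

End OriginalConfiguration.

(** * The construction of B_16 *)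

Section Construction.
Variables (F : fieldType) (a b : F).

(* Coordinates of P_1, ..., P_35 without their common factors.  The factor a + 1
   has been dropped for P_25, P_28, P_33 and P_34. *)
Definition point_coords : seq (F * F * F) :=
  let x := a ^+ 2 * b + a * b - a - b in
  let u := a ^+ 3 * b - a ^+ 2 - 2 * a * b + a + b ^+ 2 - b + 1 in
  let w := a ^+ 3 * b + a ^+ 2 * b ^+ 2 - 2 * a ^+ 2 * b - 2 * a * b + a + b in
  [:: (1, 0, 0);
      (0, 1, 0);
      (0, 0, 1);
      (1, 1, 1);
      (a, 1, 1);
      (a, 1, a);
      (a, a, 1);
      (a ^+ 2, a, 1);
      (1, a, 1);
      (a ^+ 2, 1, a);
      (1, 1, a);
      (a, 1, a ^+ 2 + a - 1);
      (a, a ^+ 2 + a - 1, 1);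
      (b, 1, 1);
      (b, 1, a);
      (b, 1, a * b + b - 1);
      (a * b, a, 1);
      (b, b, 1);
      (a * b, 1, a);
      (b, a * b + b - 1, 1);
      (b, a, 1);
      (b, 1, b);
      (a * b * x, a * x, a ^+ 2 + a * b ^+ 2 - a * b + b ^+ 2 - 2 * b);
      (a * b * u, (a * b - 1) * a * x + b * (1 - b) * (a ^+ 2 - 1), w);
      (a * x, a * x, a ^+ 2 + a * b - a - 1);
      (a * (a * b + 2 * b - 1), a + 1, a + 1);
      (b * (a - 1), a * b - b ^+ 2 + b - 1, b * (a - 1));
      (a * (a ^+ 4 * b ^+ 2 + a ^+ 3 * b ^+ 2 - 2 * a ^+ 3 * b
            - 2 * a ^+ 2 * b ^+ 2 + a ^+ 2 + a * b + b ^+ 2 - b),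
       (a - 1) * (a ^+ 2 - b) + a * (b - 1) * x, a * u);
      (a * x, a ^+ 2 + a * b - a - 1, a * x);
      (a * x, a ^+ 2 + b - 2, x);
      (a ^+ 2 - b, a ^+ 2 - b, a * x - a * b + a - b + 1);
      (b * (a + b - 2), a * b - 1, a * b - 1);
      (a ^+ 3 * b - a ^+ 2 - a * b + b, b - 1, a * (b - 1));
      (a ^+ 3 * b - a ^+ 2 - a * b + b, a * (b - 1), b - 1);
      (a * x - a ^+ 2 + b, (a + 1) * (b - 1), (a + 1) * (b - 1))].

(** Exchanging the last two coordinates sends line k to line -k modulo 16, up to sign; this matches
    the reflection symmetry of the original configuration. *)
Definition line_coords : seq (F * F * F) :=
  let x := a ^+ 2 * b + a * b - a - b in
  [:: (0, 1, -1);
      (1, 0, -1);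
      (a ^+ 2 - 1, - a * x, a * (b - 1));
      ((a + 1) * (b - 1), a ^+ 2 - b, - a * x);
      (a * b - 1, b * (1 - b), b * (1 - a));
      (1, 0, - b);
      (1, - a, 0);
      (0, 1, - a);
      (a + 1, -1, -1);
      (0, a, -1);
      (1, 0, - a);
      (1, - b, 0);
      (a * b - 1, b * (1 - a), b * (1 - b));
      ((a + 1) * (b - 1), - a * x, a ^+ 2 - b);
      (a ^+ 2 - 1, a * (b - 1), - a * x);
      (1, -1, 0)].

(* The [n]-th entry lists the lines through P_(n+1), whose indices are the
   triples with sum divisible by 16. *)
Definition incidences : seq (seq nat) :=
  [:: [:: 0; 7; 9]; [:: 1; 5; 10]; [:: 6; 11; 15]; [:: 0; 1; 15];
      [:: 0; 6; 10]; [:: 1; 6; 9]; [:: 7; 10; 15]; [:: 3; 6; 7];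
      [:: 1; 7; 8]; [:: 9; 10; 13]; [:: 8; 9; 15]; [:: 2; 6; 8];
      [:: 8; 10; 14]; [:: 0; 5; 11]; [:: 9; 11; 12]; [:: 8; 11; 13];
      [:: 7; 11; 14]; [:: 5; 12; 15]; [:: 2; 5; 9]; [:: 3; 5; 8];
      [:: 4; 5; 7]; [:: 1; 4; 11]; [:: 2; 3; 11]; [:: 6; 12; 14];
      [:: 3; 14; 15]; [:: 0; 2; 14]; [:: 1; 3; 12]; [:: 5; 13; 14];
      [:: 1; 2; 13]; [:: 2; 4; 10]; [:: 4; 13; 15]; [:: 0; 4; 12];
      [:: 3; 4; 9]; [:: 7; 12; 13]; [:: 0; 3; 13]].

Hypotheses (a_neq0 : a != 0) (a_neq1 : a != 1).
Hypotheses (b_neq0 : b != 0) (b_neq1 : b != 1).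
Hypothesis a_neqb : a != b.

(** The factor to cancel is read off from the type of [k0]. *)
Ltac cross_coords hu hv k0 :=
  apply: (has_coords_cross hu hv k0 _);
  rewrite /cross3 /scale3 /=; congr (_, _, _); ring.

(** The lines only involve P_1, ..., P_22, whose coordinates are obtained without a + 1 != 0.
    Stating them apart makes them available for deriving C16 from a concurrence, before a + 1 != 0
    is known. *)
Lemma construction_coords :
  (forall k, (k < 16)%N ->
     has_coords (lines a b)`_k (nth (0, 0, 0) line_coords k))
  /\ (a + 1 != 0 -> forall n, (n < 35)%N ->
     has_coords (P a b n.+1) (nth (0, 0, 0) point_coords n)).
Proof.
pose x := a ^+ 2 * b + a * b - a - b.
have u1 : (1 : F) != 0 := oner_neq0 F.
have N1 : (-1 : F) != 0 by rewrite oppr_eq0.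
have Na0 : - a != 0 by rewrite oppr_eq0.
have a1 : a - 1 != 0 by rewrite subr_eq0.
have p1 : has_coords (P a b 1) (1, 0, 0).
  exact: has_coords_row3.
have p2 : has_coords (P a b 2) (0, 1, 0).
  exact: has_coords_row3.
have p3 : has_coords (P a b 3) (0, 0, 1).
  exact: has_coords_row3.
have p4 : has_coords (P a b 4) (1, 1, 1).
  exact: has_coords_row3.
have p5 : has_coords (P a b 5) (a, 1, 1).
  exact: has_coords_row3.
have l2_4 : has_coords (PP a b 2 4) (1, 0, -1).
  by cross_coords p2 p4 u1.
have l3_5 : has_coords (PP a b 3 5) (1, - a, 0).
  by cross_coords p3 p5 N1.
have p6 : has_coords (P a b 6) (a, 1, a).
  by cross_coords l2_4 l3_5 N1.
have l3_4 : has_coords (PP a b 3 4) (1, -1, 0).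
  by cross_coords p3 p4 N1.
have l2_5 : has_coords (PP a b 2 5) (1, 0, - a).
  by cross_coords p2 p5 u1.
have p7 : has_coords (P a b 7) (a, a, 1).
  by cross_coords l3_4 l2_5 u1.
have l1_7 : has_coords (PP a b 1 7) (0, 1, - a).
  by cross_coords p1 p7 N1.
have p8 : has_coords (P a b 8) (a ^+ 2, a, 1).
  by cross_coords l3_5 l1_7 u1.
have p9 : has_coords (P a b 9) (1, a, 1).
  by cross_coords l2_4 l1_7 u1.
have l1_6 : has_coords (PP a b 1 6) (0, a, -1).
  by cross_coords p1 p6 N1.
have p10 : has_coords (P a b 10) (a ^+ 2, 1, a).
  by cross_coords l1_6 l2_5 N1.
have p11 : has_coords (P a b 11) (1, 1, a).
  by cross_coords l3_4 l1_6 u1.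
have l9_11 : has_coords (PP a b 9 11) (a + 1, -1, -1).
  by cross_coords p9 p11 a1.
have p12 : has_coords (P a b 12) (a, 1, a ^+ 2 + a - 1).
  by cross_coords l9_11 l3_5 N1.
have p13 : has_coords (P a b 13) (a, a ^+ 2 + a - 1, 1).
  by cross_coords l9_11 l2_5 u1.
have p14 : has_coords (P a b 14) (b, 1, 1).
  exact: has_coords_row3.
have l3_14 : has_coords (PP a b 3 14) (1, - b, 0).
  by cross_coords p3 p14 N1.
have p15 : has_coords (P a b 15) (b, 1, a).
  by cross_coords l3_14 l1_6 u1.
have p16 : has_coords (P a b 16) (b, 1, a * b + b - 1).
  by cross_coords l3_14 l9_11 u1.
have p17 : has_coords (P a b 17) (a * b, a, 1).
  by cross_coords l3_14 l1_7 u1.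
have l2_14 : has_coords (PP a b 2 14) (1, 0, - b).
  by cross_coords p2 p14 u1.
have p18 : has_coords (P a b 18) (b, b, 1).
  by cross_coords l2_14 l3_4 N1.
have p19 : has_coords (P a b 19) (a * b, 1, a).
  by cross_coords l2_14 l1_6 u1.
have p20 : has_coords (P a b 20) (b, a * b + b - 1, 1).
  by cross_coords l2_14 l9_11 N1.
have p21 : has_coords (P a b 21) (b, a, 1).
  by cross_coords l2_14 l1_7 u1.
have p22 : has_coords (P a b 22) (b, 1, b).
  by cross_coords l2_4 l3_14 N1.
have l1_4 : has_coords (PP a b 1 4) (0, 1, -1).
  by cross_coords p1 p4 N1.
have l12_19 : has_coords (PP a b 12 19) (a ^+ 2 - 1, - a * x, a * (b - 1)).
  by rewrite /x; cross_coords p12 p19 N1.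
have l8_20 : has_coords (PP a b 8 20) ((a + 1) * (b - 1), a ^+ 2 - b, - a * x).
  by rewrite /x; cross_coords p8 p20 N1.
have l21_22 : has_coords (PP a b 21 22) (a * b - 1, b * (1 - b), b * (1 - a)).
  by cross_coords p21 p22 u1.
have l15_18 : has_coords (PP a b 15 18) (a * b - 1, b * (1 - a), b * (1 - b)).
  by cross_coords p15 p18 N1.
have l10_16 : has_coords (PP a b 10 16) ((a + 1) * (b - 1), - a * x, a ^+ 2 - b).
  by rewrite /x; cross_coords p10 p16 u1.
have l13_17 : has_coords (PP a b 13 17) (a ^+ 2 - 1, a * (b - 1), - a * x).
  by rewrite /x; cross_coords p13 p17 u1.
subst x; split.
  case=> [_|]; first exact: l1_4.
  case=> [_|]; first exact: l2_4.
  case=> [_|]; first exact: l12_19.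
  case=> [_|]; first exact: l8_20.
  case=> [_|]; first exact: l21_22.
  case=> [_|]; first exact: l2_14.
  case=> [_|]; first exact: l3_5.
  case=> [_|]; first exact: l1_7.
  case=> [_|]; first exact: l9_11.
  case=> [_|]; first exact: l1_6.
  case=> [_|]; first exact: l2_5.
  case=> [_|]; first exact: l3_14.
  case=> [_|]; first exact: l15_18.
  case=> [_|]; first exact: l10_16.
  case=> [_|]; first exact: l13_17.
  case=> [_|]; first exact: l3_4.
  by [].
move=> ap1.
(* The factor -(a + 1) is cancelled from P_33 and P_34, and (a - b)(a + 1) from P_25. *)
have Nap1 : - a - 1 != 0 by rewrite -opprD oppr_eq0.
have aba1 : (a - b) * (a + 1) != 0 by rewrite mulf_neq0 // subr_eq0.
have p23 : has_coords (P a b 23) (nth (0, 0, 0) point_coords 22).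
  by rewrite [nth _ _ _]/=; cross_coords l3_14 l8_20 u1.
have p24 : has_coords (P a b 24) (nth (0, 0, 0) point_coords 23).
  by rewrite [nth _ _ _]/=; cross_coords l15_18 l13_17 u1.
have p25 : has_coords (P a b 25) (nth (0, 0, 0) point_coords 24).
  by rewrite [nth _ _ _]/=; cross_coords l13_17 l8_20 aba1.
have p26 : has_coords (P a b 26) (nth (0, 0, 0) point_coords 25).
  by rewrite [nth _ _ _]/=; cross_coords l13_17 l1_4 a1.
have p27 : has_coords (P a b 27) (nth (0, 0, 0) point_coords 26).
  by rewrite [nth _ _ _]/=; cross_coords l2_4 l15_18 N1.
have p28 : has_coords (P a b 28) (nth (0, 0, 0) point_coords 27).
  by rewrite [nth _ _ _]/=; cross_coords l10_16 l13_17 ap1.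
have p29 : has_coords (P a b 29) (nth (0, 0, 0) point_coords 28).
  by rewrite [nth _ _ _]/=; cross_coords l2_4 l10_16 N1.
have p30 : has_coords (P a b 30) (nth (0, 0, 0) point_coords 29).
  by rewrite [nth _ _ _]/=; cross_coords l2_5 l12_19 Na0.
have p31 : has_coords (P a b 31) (nth (0, 0, 0) point_coords 30).
  by rewrite [nth _ _ _]/=; cross_coords l10_16 l3_4 u1.
have p32 : has_coords (P a b 32) (nth (0, 0, 0) point_coords 31).
  by rewrite [nth _ _ _]/=; cross_coords l1_4 l15_18 N1.
have p33 : has_coords (P a b 33) (nth (0, 0, 0) point_coords 32).
  by rewrite [nth _ _ _]/=; cross_coords l1_6 l8_20 Nap1.
have p34 : has_coords (P a b 34) (nth (0, 0, 0) point_coords 33).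
  by rewrite [nth _ _ _]/=; cross_coords l1_7 l10_16 Nap1.
have p35 : has_coords (P a b 35) (nth (0, 0, 0) point_coords 34).
  by rewrite [nth _ _ _]/=; cross_coords l1_4 l10_16 N1.
do 35![case=> [_|];
  first by match goal with
    H : has_coords (P a b ?n) _ |- has_coords (P a b ?n) _ => exact: H end].
by [].
Qed.

Lemma incident (n k : nat) : C16 a b = 0 -> (n < 35)%N ->
  k \in nth [::] incidences n ->
  dot3 (nth (0, 0, 0) point_coords n) (nth (0, 0, 0) line_coords k) = 0.
Proof.
move=> C0.
(* The cofactors 1, -1, a, -a and -a(a + 1) suffice for the incidences that are not polynomial
   identities. *)
have C0M m e : e = m * C16 a b -> e = 0 by move=> ->; rewrite C0 mulr0.
move: n; do 35![case=> [_|];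
  first by rewrite !inE => /or3P[] /eqP->; rewrite /dot3 /=;
    first [ring | apply: (C0M 1); rewrite /C16; ring
          | apply: (C0M (-1)); rewrite /C16; ring
          | apply: (C0M a); rewrite /C16; ring
          | apply: (C0M (- a)); rewrite /C16; ring
          | apply: (C0M (- a * (a + 1))); rewrite /C16; ring]].
by [].
Qed.

(** At a = -1 the polynomial becomes -(b + 1)^2 (b - 1), which is nonzero because b differs from a
    and from 1. *)
Lemma C16_neqN1 : C16 a b = 0 -> a + 1 != 0.
Proof.
apply: contra_eq_neq => /eqP; rewrite addr_eq0 => /eqP aN1.
have -> : C16 a b = - (b - a) ^+ 2 * (b - 1) by rewrite /C16 aN1; ring.
by rewrite mulf_neq0 ?oppr_eq0 ?expf_neq0 // subr_eq0 // eq_sym.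
Qed.

(* Each of P_23, ..., P_35 is excluded from vanishing by writing a product of
   powers of [a], [b], [a - 1], [b - 1] and [a - b] as a combination of its
   coordinates, so the argument holds in every characteristic. *)
Lemma point_coords_neq0 (n : nat) : (n < 35)%N ->
  nth (0, 0, 0) point_coords n != (0, 0, 0).
Proof.
have a1 : a - 1 != 0 by rewrite subr_eq0.
have b1 : b - 1 != 0 by rewrite subr_eq0.
have ba : b - a != 0 by rewrite subr_eq0 eq_sym.
have ab : a - b != 0 by rewrite subr_eq0.
have nz := (mulf_neq0, expf_neq0, oppr_eq0).
(* Each of P_1, ..., P_22 has a coordinate equal to 1. *)
move: n; do 22![case=> [_|]; first by rewrite /= !xpair_eqE oner_eq0 ?andbF].
case=> [_|].
  apply: (coords_neq0 (m1 := 0) (m2 := a + b ^+ 2 - 2 * b) (m3 := - (a - 1) *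
    a * b) (m := (a ^+ 2 * (b - a) * (b - 1) ^+ 2))); last by ring.
  by rewrite ?nz.
case=> [_|].
  apply: (coords_neq0 (m1 := - (a ^+ 2 * b + a * b ^+ 2 - 3 * a * b - b ^+ 2 +
    2 * b)) (m2 := 0) (m3 := - a * b * (b - 1) ^+ 2 * (a - 1) + a * b * (a ^+
    2 * b + a * b ^+ 2 - 3 * a * b - b ^+ 2 + 2 * b)) (m := (- (a * b * (b -
    1) ^+ 3 * (b - a) * (a - 1))))); last by ring.
  by rewrite ?nz.
case=> [_|].
  apply: (coords_neq0 (m1 := - (a + b - 2) ^+ 2) (m2 := 0) (m3 := ((a ^+ 2 + a
    * b - a - 1) - 2 * (a + 1) * (a + b - 2)) * (a - 1) ^+ 2 + (a + b - 2) ^+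
    2 * (a ^+ 2 + a - 1)) (m := ((b - 1) ^+ 2 * (a - 1) ^+ 2))); last by ring.
  by rewrite ?nz.
case=> [_|].
  apply: (coords_neq0 (m1 := -1) (m2 := a * b + b - 1) (m3 := 0) (m := (b -
    1))); last by ring.
  by rewrite ?nz.
case=> [_|].
  apply: (coords_neq0 (m1 := 1) (m2 := 0) (m3 := 0) (m := (b * (a - 1))));
    last by ring.
  by rewrite ?nz.
case=> [_|].
  apply: (coords_neq0 (m1 := 0) (m2 := a * (a - 1) * (((b - 1) ^+ 2 + (b - 1)
    * (a - 1) + (a - 1) ^+ 2) + (a - 1) ^+ 2 * (b - 1))) (m3 := - ((a - b) *
    ((b - 1) ^+ 2 + (b - 1) * (a - 1) + (a - 1) ^+ 2) + a * (b - 1) * (((b -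
    1) ^+ 2 + (b - 1) * (a - 1) + (a - 1) ^+ 2) + (a - 1) ^+ 2 * (b - 1))))
    (m := (a * (a - 1) * (b - 1) ^+ 4 * (a - b)))); last by ring.
  by rewrite ?nz.
(* P_29 is P_25 with its last two coordinates exchanged, so the same certificate works with [m2] and
   [m3] exchanged. *)
case=> [_|].
  apply: (coords_neq0 (m1 := - (a + b - 2) ^+ 2) (m2 := ((a ^+ 2 + a * b - a -
    1) - 2 * (a + 1) * (a + b - 2)) * (a - 1) ^+ 2 + (a + b - 2) ^+ 2 * (a ^+
    2 + a - 1)) (m3 := 0) (m := ((b - 1) ^+ 2 * (a - 1) ^+ 2))); last by ring.
  by rewrite ?nz.
case=> [_|].
  apply: (coords_neq0 (m1 := 0) (m2 := b) (m3 := -1) (m := ((b - 1) * (b -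
    a)))); last by ring.
  by rewrite ?nz.
case=> [_|].
  apply: (coords_neq0 (m1 := - a ^+ 2 * b + a - b ^+ 2 + 3 * b - 2) (m2 := 0)
    (m3 := a - 1) (m := ((b - 1) ^+ 3))); last by ring.
  by rewrite ?nz.
case=> [_|].
  apply: (coords_neq0 (m1 := 1) (m2 := -1) (m3 := 0) (m := ((b - 1) ^+ 2)));
    last by ring.
  by rewrite ?nz.
case=> [_|].
  apply: (coords_neq0 (m1 := 0) (m2 := 1) (m3 := 0) (m := (b - 1))); last by
    ring.
  by rewrite ?nz.
case=> [_|].
  apply: (coords_neq0 (m1 := 0) (m2 := 0) (m3 := 1) (m := (b - 1))); last by
    ring.
  by rewrite ?nz.
case=> [_|].
  apply: (coords_neq0 (m1 := - (b - 1)) (m2 := a ^+ 2 * b - 2 * a + 1)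
    (m3 := 0) (m := ((b - 1) ^+ 2 * (a - 1)))); last by ring.
  by rewrite ?nz.
by [].
Qed.

(** * From the equation C16 to the incidences *)

Lemma incident_on_line (n k : nat) : C16 a b = 0 -> (n < 35)%N ->
  k \in nth [::] incidences n -> on_line (P a b n.+1) (lines a b)`_k.
Proof.
move=> C0 ltn35 kn; have [lineP pointP] := construction_coords.
have ltk16 : (k < 16)%N.
  have /(all_nthP [::])/(_ n ltn35)/allP/(_ k kn) // :
    all (all (fun k => k < 16)%N) incidences by [].
rewrite (has_coords_on_line (pointP (C16_neqN1 C0) n ltn35) (lineP k ltk16)).
by rewrite incident.
Qed.

Lemma point_neq0 (n : nat) : C16 a b = 0 -> (n < 35)%N -> P a b n.+1 != 0.
Proof.
move=> C0 ltn35; have [_ pointP] := construction_coords.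
have ap1 := C16_neqN1 C0.
by rewrite (has_coords_neq0 (pointP ap1 n ltn35)) point_coords_neq0.
Qed.

Lemma C16_triple_point (n : nat) : C16 a b = 0 -> (n < 35)%N ->
  triple_point a b (P a b n.+1).
Proof.
move=> C0 ltn35; split; first exact: point_neq0.
set s := nth [::] incidences n.
have /and3P[/eqP s3 us s16] : [&& size s == 3%N, uniq s & all (fun k => k < 16)%N s].
  by have /(all_nthP [::])/(_ n ltn35) : all (fun s => [&& size s == 3%N, uniq s
    & all (fun k => k < 16)%N s]) incidences by [].
(* [@inord 15] lands in 'I_16 and preserves only values below 16. The bound [s16] therefore ensures
   that the three listed indices stay distinct as ordinals. *)
have inordE k : k \in s -> @inord 15 k = k :> nat.
  by move=> /(allP s16) ltk16; rewrite inordK.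
have us' : uniq (map (@inord 15) s).
  rewrite map_inj_in_uniq // => j k js ks jk.
  by rewrite -(inordE j js) jk inordE.
apply: (@leq_trans (size (map (@inord 15) s))); first by rewrite size_map s3.
rewrite -(card_uniqP us').
apply/subset_leq_card/subsetP=> _ /mapP[k ks ->].
by rewrite inE /L inordE // incident_on_line.
Qed.

Lemma C16_produces (R : realType) : C16 a b = 0 -> produces_triple_points a b R.
Proof.
move=> C0; split=> [[//|n] /andP[_ len35]|i j k ij ik jk].
  exact: C16_triple_point.
move=> /(boroczky_concurrent R (ltn_ord i) (ltn_ord j) (ltn_ord k) ij ik jk) dvd16.
(* A finite check over all index triples: each one that is distinct with sum divisible by 16 occurs
   in some entry of the table. *)
have covered : all (fun i => all (fun j => all (fun k =>
    [&& i != j, i != k, j != k & (16 %| i + j + k)%N] ==>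
      has (fun s => [&& i \in s, j \in s & k \in s]) incidences)
    (iota 0 16)) (iota 0 16)) (iota 0 16) by vm_compute.
have mem16 (l : 'I_16) : val l \in iota 0 16 by rewrite mem_iota /= ltn_ord.
have /implyP := allP (allP (allP covered i (mem16 i)) j (mem16 j)) k (mem16 k).
rewrite ij ik jk => /(_ dvd16)/(has_nthP [::])[n ltn35 /and3P[is_ js ks]].
by exists n.+1; rewrite ?incident_on_line.
Qed.

Lemma C16_concurrences : C16 a b = 0 -> seven_concurrences a b.
Proof.
move=> C0; have [_ pointP] := construction_coords.
(* The common point is P_(n+1), so the entry 22 used below stands for P_23. *)
have through n k1 k2 k3 : (n < 35)%N ->
    all (fun k => k \in nth [::] incidences n) [:: k1; k2; k3] ->
    concurrent (lines a b)`_k1 (lines a b)`_k2 (lines a b)`_k3.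
  move=> ltn35 /and4P[k1n k2n k3n _]; exists (P a b n.+1).
  by rewrite point_neq0 // !incident_on_line.
split; first exact: (through 22 11 3 2).
split; last first.
  split; first exact: (through 26 1 3 12).
  split; first exact: (through 27 5 13 14).
  split; first exact: (through 29 10 2 4).
  split; first exact: (through 32 9 3 4).
  exact: (through 33 7 13 12).
(* The second concurrence names P_3P_6, whereas [lines] contains P_3P_5. Both have coordinates (1,
   -a, 0), so the incidence of P_24 transfers. *)
have P24P3P6 : on_line (P a b 24) (PP a b 3 6).
  have l3_6 : has_coords (PP a b 3 6) (1, - a, 0).
    apply: (has_coords_cross (pointP (C16_neqN1 C0) 2 isT)
      (pointP (C16_neqN1 C0) 5 isT) (k := -1)); first by rewrite oppr_eq0 oner_eq0.
    by rewrite /cross3 /scale3 /=; congr (_, _, _); ring.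
  have l3_5 := construction_coords.1 6 isT.
  have p24 := pointP (C16_neqN1 C0) 23 isT.
  rewrite (has_coords_on_line p24 l3_6) -(has_coords_on_line p24 l3_5).
  exact: incident_on_line.
exists (P a b 24); split=> //; first exact: (point_neq0 (n := 23)).
  exact: (incident_on_line (n := 23) (k := 14)).
exact: (incident_on_line (n := 23) (k := 12)).
Qed.

(** * From concurrence back to the equation C16 *)

Lemma concurrent_C16 :
  concurrent (lines a b)`_1 (lines a b)`_3 (lines a b)`_12 -> C16 a b = 0.
Proof.
have [lineP _] := construction_coords.
move=> /(concurrent_dot3 (lineP 1 isT) (lineP 3 isT) (lineP 12 isT)) D0.
by apply: oppr_inj; rewrite oppr0 -[RHS]D0 /dot3 /= /C16; ring.
Qed.

Lemma concurrences_C16 : seven_concurrences a b -> C16 a b = 0.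
Proof. by case=> _ [_ [/concurrent_C16]]. Qed.

Lemma produces_C16 (R : realType) : produces_triple_points a b R -> C16 a b = 0.
Proof.
case=> tripleP coveredP; apply: concurrent_C16.
have [||||n n35 [nl1 nl3 nl12]] :=
  coveredP (@Ordinal 16 1 isT) (@Ordinal 16 3 isT) (@Ordinal 16 12 isT).
- by [].
- by [].
- by [].
- exact/(@boroczky_concurrent R 16).
by exists (P a b n); have [n0 _] := tripleP n n35.
Qed.

(** Ten of the lines have a coordinate 1 or -1. For the other six a combination of the coordinates
    equals a product of a, b, a - 1 and b - 1. *)
Lemma line_neq0 (k : 'I_16) : L a b k != 0.
Proof.
have [lineP _] := construction_coords.
rewrite (has_coords_neq0 (lineP k (ltn_ord k))).
have a1 : a - 1 != 0 by rewrite subr_eq0.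
have b1 : b - 1 != 0 by rewrite subr_eq0.
case: k => -[|[|[|[|[|[|[|[|[|[|[|[|[|[|[|[|//]]]]]]]]]]]]]]]] /= _;
  try by rewrite !xpair_eqE ?oppr_eq0 oner_eq0 ?andbF.
- by apply: (coords_neq0 (m1 := 0) (m2 := 0) (m3 := 1) (m := a * (b - 1)));
    [rewrite mulf_neq0 | ring].
- by apply: (coords_neq0 (m1 := a - 1) (m2 := 1 - b) (m3 := 0) (m := (b - 1) ^+ 2));
    [rewrite expf_neq0 | ring].
- by apply: (coords_neq0 (m1 := 0) (m2 := 0) (m3 := -1) (m := b * (a - 1)));
    [rewrite mulf_neq0 | ring].
- by apply: (coords_neq0 (m1 := 0) (m2 := -1) (m3 := 0) (m := b * (a - 1)));
    [rewrite mulf_neq0 | ring].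
- by apply: (coords_neq0 (m1 := a - 1) (m2 := 0) (m3 := 1 - b) (m := (b - 1) ^+ 2));
    [rewrite expf_neq0 | ring].
- by apply: (coords_neq0 (m1 := 0) (m2 := 1) (m3 := 0) (m := a * (b - 1)));
    [rewrite mulf_neq0 | ring].
Qed.

End Construction.

Theorem mainTheorem5 (R : realType) (F : fieldType) (a b : F)
    (a_neq0 : a != 0) (a_neq1 : a != 1) (b_neq0 : b != 0) (b_neq1 : b != 1)
    (a_neqb : a != b) :
  [/\ (forall k : 'I_16, L a b k != 0),
      produces_triple_points a b R <-> seven_concurrences a b,
      seven_concurrences a b <-> C16 a b = 0
    & produces_triple_points a b R <-> C16 a b = 0].
Proof.
split; first exact: line_neq0.
- split=> [/produces_C16 C0|/concurrences_C16 C0].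
    by apply: C16_concurrences => //; apply: C0.
  by apply: C16_produces => //; apply: C0.
- by split; [apply: concurrences_C16 | apply: C16_concurrences].
- by split; [apply: produces_C16 | apply: C16_produces].
Qed.
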